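(* Let $\mathbbm{k}$ be a field of characteristic $0$, let $N \geqslant 2$ and $s \geqslant 4^N$. Let $I \subseteq \mathbbm{k}[x_0,\dots,x_N]$ be the defining ideal of a general set of $s$ points in $\mathbb{P}^N_{\mathbbm{k}}$. Then for every $m \in \mathbb{N}$, $$\frac{\alpha(I^{(m)})}{m} \geqslant \frac{\alpha(I)+N-1}{N}.$$
   Context: For a homogeneous ideal $J$, $\alpha(J)$ denotes the least degree of a nonzero homogeneous element of $J$. For the ideal $I$ of a finite set of points with point ideals $\mathfrak{p}_1,\dots,\mathfrak{p}_s$, $I^{(m)} = \mathfrak{p}_1^m \cap \dots \cap \mathfrak{p}_s^m$. A property holds for a general set of $s$ points in $\mathbb{P}^N_{\mathbbm{k}}$ if there is a nonempty Zariski open subset $U$ of the parameter space of $s$ points (e.g. of $\mathbb{A}^{s(N+1)}_{\mathbbm{k}}$, with $\mathbf{a}=(a_{ij})$ giving the points $[a_{i0}:\dots:a_{iN}]$) such that the property holds for every set of points corresponding to a point of $U$. *)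

(* Defs.v *)
From HB Require Import structures.
From mathcomp Require Import all_boot all_order all_algebra.
From mathcomp Require Import mpoly.
From Stdlib Require Import ClassicalEpsilon.
Set Implicit Arguments.
Unset Strict Implicit.
Unset Printing Implicit Defensive.
Import Order.TTheory GRing.Theory Num.Theory.
Local Open Scope ring_scope.

Definition homog_of_deg (k : fieldType) (n d : nat) (f : {mpoly k[n]}) : bool :=
  f \is (@ishomog1 n k d mdeg).

(* An ideal is represented by its membership predicate. *)
(* alpha J = least degree of a nonzero homogeneous element of J
   (set to 0 by convention if J has no nonzero homogeneous element). *)
Definition has_hom_elt (k : fieldType) (n : nat) (J : {mpoly k[n]} -> Prop)
  (d : nat) : Prop :=
  exists f : {mpoly k[n]}, J f /\ f != 0 /\ homog_of_deg d f.

Definition is_least_hom_deg (k : fieldType) (n : nat)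
  (J : {mpoly k[n]} -> Prop) (d : nat) : Prop :=
  has_hom_elt J d /\ forall d', has_hom_elt J d' -> (d <= d')%N.

Definition alpha (k : fieldType) (n : nat) (J : {mpoly k[n]} -> Prop) : nat :=
  match excluded_middle_informative (exists d, is_least_hom_deg J d) with
  | left H => proj1_sig (constructive_indefinite_description _ H)
  | right _ => 0%N
  end.

(* The ideal of the point [a_0 : ... : a_N] of P^N (a <> 0): the homogeneous
   polynomials vanishing at it, i.e. the polynomials vanishing on the line
   k.a of A^{N+1} (the prime ideal generated by the 2x2 minors). *)
Definition point_ideal (k : fieldType) (n : nat) (a : 'rV[k]_n)
  (f : {mpoly k[n]}) : Prop :=
  forall t : k, f.@[fun j => t * a 0 j] = 0.

Definition ideal_pow (k : fieldType) (n : nat) (J : {mpoly k[n]} -> Prop)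
  (m : nat) (f : {mpoly k[n]}) : Prop :=
  exists r : seq ({mpoly k[n]} * m.-tuple {mpoly k[n]}),
    (forall x, x \in r -> forall g, g \in tval x.2 -> J g) /\
    f = \sum_(x <- r) x.1 * \prod_(g <- tval x.2) g.

(* The points are the rows of a matrix A : 'M_(s, N+1). *)
Definition points_ideal (k : fieldType) (s n : nat) (A : 'M[k]_(s, n))
  (f : {mpoly k[n]}) : Prop :=
  forall i : 'I_s, point_ideal (row i A) f.

Definition symbolic_power (k : fieldType) (s n : nat) (A : 'M[k]_(s, n))
  (m : nat) (f : {mpoly k[n]}) : Prop :=
  forall i : 'I_s, ideal_pow (point_ideal (row i A)) m f.

Definition distinct_proj_points (k : fieldType) (s n : nat) (A : 'M[k]_(s, n))
  : Prop :=
  (forall i : 'I_s, row i A != 0) /\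
  (forall i j : 'I_s, i != j -> ~ exists c : k, row j A = c *: row i A).

Definition zariski_open (k : fieldType) (n : nat) (U : ('I_n -> k) -> Prop)
  : Prop :=
  exists S : {mpoly k[n]} -> Prop,
    forall v, U v <-> exists g, S g /\ g.@[v] != 0.

Definition general_points (k : fieldType) (s N : nat)
  (P : 'M[k]_(s, N.+1) -> Prop) : Prop :=
  exists U : ('I_(s * N.+1) -> k) -> Prop,
    zariski_open U /\ (exists v, U v) /\
    forall A : 'M[k]_(s, N.+1),
      U (fun i => mxvec A 0 i) -> distinct_proj_points A /\ P A.

(* Main.v *)
Require Import Defs.
From HB Require Import structures.
From mathcomp Require Import all_boot all_order all_algebra all_field.
From mathcomp Require Import mpoly zify.
From Stdlib Require Import Classical ClassicalEpsilon FunctionalExtensionality.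
Set Implicit Arguments.
Unset Strict Implicit.
Unset Printing Implicit Defensive.
Import Order.TTheory GRing.Theory Num.Theory.
Local Open Scope ring_scope.

(** For A general, alpha(I^(m)) / m is bounded below uniformly in m as follows.
    Put t = floor(s^(1/N)).  Since s < (t+1)^N <= binomial(tN, N), every set of
    s points lies on a hypersurface of degree (t-1)N, so alpha(I) + N - 1 < tN.
    On the grid {0,...,t-1}^N a nonzero polynomial with multiplicity >= M at
    all points has degree >= tM; for one fixed M this persists on a Zariski
    open set U.  For A in U, a form f of degree e with multiplicity >= l at the
    points satisfies l t M <= e (M + N + 1).  Indeed, specialize f and A to a
    field of characteristic p.  There, with q a power of p, a component of the
    expansion of (a monomial times) f^r in the basis x^i, i < q, over the q-th
    powers is a form of degree at most e r / q whose multiplicity at the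
    Frobenius images of the points is at least r l / q - (N + 1); take
    r ~ q (M + N + 1) / l and let q grow.  The loss of the factor
    M / (M + N + 1) is absorbed for M = tN(N + 1) by the strict inequality
    alpha(I) + N - 1 < tN. *)

(** * Binomial estimates and the integer part of the N-th root *)

(** Vandermonde's expansion of ['C(t * N + t, N.+1)] ends with [t * 'C(t * N, N)] and
    ['C(t * N, N.+1)]; the latter is at least ['C(t * N, N)] once [t > 2]. *)
Lemma bin_mul_step (t N : nat) : (2 < t)%N -> (0 < N)%N ->
  (t.+1 * 'C(t * N, N) <= 'C(t * N.+1, N.+1))%N.
Proof.
move=> t_gt2 N_gt0.
have le1 : ('C(t * N, N) <= 'C(t * N, N.+1))%N.
  rewrite -(leq_pmul2l (ltn0Sn N)) mul_bin_left leq_mul2r; apply/orP; right.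
  by nia.
rewrite mulnS addnC -binomial.Vandermonde; rewrite !big_ord_recr /= subnn bin0 muln1.
rewrite subSnn bin1 mulSn.
have -> : ((t * N) = N * t)%N by rewrite mulnC.
by move: le1; rewrite mulnC; nia.
Qed.

(** Induction from N = 2, where the claim reads (t+1)^2 <= t(2t-1). This fails at t = 3; the bound
    [3 < t] is what s >= 4^N provides. *)
Lemma expn_le_bin (t N : nat) : (3 < t)%N -> (1 < N)%N ->
  (t.+1 ^ N <= 'C(t * N, N))%N.
Proof.
move=> t_gt3; elim: N => // -[//|[_ _|N IH _]].
  rewrite -(leq_pmul2l (isT : (0 < 2)%N)) -[X in (_ <= X * _)%N]/(2`!) mulnC.
  by rewrite -[X in (_ <= X)%N]mulnC bin_ffact !ffactnS ffactn0; nia.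
rewrite expnS (leq_trans _ (@bin_mul_step _ _ _ _)) ?leq_mul2l ?IH ?orbT //.
exact: ltnW.
Qed.

Lemma expn_floor_root (N s : nat) : (0 < N)%N -> (4 ^ N <= s)%N ->
  exists t, [/\ (3 < t)%N, (t ^ N <= s)%N & (s < t.+1 ^ N)%N].
Proof.
move=> N_gt0 s_ge.
have ex : exists t, (t ^ N <= s)%N by exists 4.
have bd t : (t ^ N <= s)%N -> (t <= s)%N.
  case: t => // t; apply: leq_trans; case: N N_gt0 {s_ge ex} => // N _.
  by rewrite expnS leq_pmulr // expn_gt0.
case: (ex_maxnP ex bd) => t tP tmax; exists t; split=> //; first exact: tmax.
by rewrite ltnNge; apply/negP => /tmax; rewrite ltnn.
Qed.

(** * Specialization to positive characteristic *)

(** The kernel condition makes [phi] factor through the image of [iota], without forming that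
    subring of [K] as a type. The target is algebraically closed so that roots and non-roots of
    polynomials can be picked in it. *)
Definition specializable {R : comNzRingType} {K : fieldType}
    (iota : {rmorphism R -> K}) : Prop :=
  forall r, iota r != 0 ->
    exists (Om : closedFieldType) (p : nat) (phi : {rmorphism R -> Om}),
      [/\ p \in [pchar Om], forall x, iota x = 0 -> phi x = 0 & phi r != 0].

(** A prime p > |r| does not divide r, so r survives in an algebraic closure of F_p. *)
Lemma specializable_int (K : fieldType) :
  [pchar K] =i pred0 -> specializable (intr : {rmorphism int -> K}).
Proof.
move=> K0 r r_neq0.
have r0 : r != 0 by apply: contraNneq r_neq0 => ->; rewrite rmorph0.
have [p p_gt p_pr] := prime_above `|r|.
have [Om [FtoOm _]] := countable_algebraic_closure 'F_p.
have pOm : p \in [pchar Om].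
  by rewrite (fmorph_pchar FtoOm) pchar_Fp.
exists Om, p, intr; split=> // [x /eqP|].
  have /pcharf0P chK := K0.
  case: x => m.
    by rewrite /= -pmulrn chK => /eqP->.
  by rewrite NegzE rmorphN /= oppr_eq0 -pmulrn chK.
have -> : (r%:~R == 0 :> Om) = (`|r|%:R == 0 :> Om).
  by case: r {r_neq0 r0 p_gt} => m //; rewrite NegzE rmorphN /= oppr_eq0.
rewrite -(dvdn_pcharf pOm); apply/negP => /dvdn_leq; rewrite absz_gt0 r0.
by move=> /(_ isT); rewrite leqNgt p_gt.
Qed.

Section PolynomialExtension.
Import Pdiv.CommonRing Pdiv.ComRing.
Variables (R : comNzRingType) (K : fieldType) (iota : {rmorphism R -> K}).
Local Notation "P ^i" := (map_poly iota P) (at level 2, format "P ^i").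

Lemma map_poly_ker (Om : fieldType) (phi : {rmorphism R -> Om}) P Q :
    (forall x, iota x = 0 -> phi x = 0) ->
  P^i = Q^i -> map_poly phi P = map_poly phi Q.
Proof.
move=> kphi PQ; apply/eqP; rewrite -subr_eq0 -rmorphB; apply/eqP/polyP => i.
rewrite coef_map coef0 /=; apply: kphi.
by rewrite -coef_map rmorphB /= PQ subrr coef0.
Qed.

(** Euclidean division on images in [K], without inverses: [W] has least size among the members of
    [S] with nonzero image, and the pseudo-remainder of [P] by [W] is a shorter member of [S], so
    its image is 0. *)
Lemma minimal_divisor (S : {poly R} -> Prop) :
    (forall P Q, P^i = Q^i -> S P -> S Q) ->
    (forall P Q c W, S P -> S W -> S (c *: P - Q * W)) ->
    (exists2 P, S P & P^i != 0) ->
  exists W, [/\ S W, iota (lead_coef W) != 0 & forall P, S P ->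
    exists j Q, (lead_coef W ^+ j *: P)^i = (Q * W)^i].
Proof.
move=> Sext Sdiv exP.
pose A n := exists W, [/\ S W, W^i != 0 & (size W <= n)%N].
have [n [An minn]] : exists n, A n /\ forall n', A n' -> (n <= n')%N.
  case: exP => P SP P0; have : A (size P) by exists P.
  elim/ltn_ind: (size P) => n IH An.
  have [|] := classic (exists2 n', A n' & (n' < n)%N).
    by case=> n' An' /IH; apply.
  move=> H; exists n; split=> // n' An'; rewrite leqNgt; apply/negP => lt.
  by apply: H; exists n'.
case: An => W [SW W0 sW].
(* A leading coefficient killed by [iota] could be cut off without changing the image, against
   minimality. *)
have lW : iota (lead_coef W) != 0.
  apply/eqP => l0; pose W' := take_poly (size W).-1 W.
  have W'i : W^i = W'^i.
    apply/polyP => i; rewrite !coef_map coef_take_poly.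
    case: ltnP => //=; rewrite leq_eqVlt => /predU1P[<-|le].
      by rewrite rmorph0 -l0.
    rewrite rmorph0 nth_default ?rmorph0 //; by case: (size W) le.
  have /minn : A (size W').
    by exists W'; split=> //; [exact: Sext W'i SW | rewrite -W'i].
  rewrite leqNgt; apply/negP; rewrite negbK (leq_trans _ sW) //.
  rewrite (leq_ltn_trans (size_take_poly _ _)) // prednK // lt0n.
  by apply: contraNneq W0 => /eqP; rewrite size_poly_eq0 => /eqP->; rewrite rmorph0.
have W00 : W != 0 by apply: contraNneq W0 => ->; rewrite rmorph0.
exists W; split=> // P SP; exists (rscalp P W), (rdivp P W).
rewrite rdivp_eq rmorphD /=.
have [->|Rm0] := eqVneq (rmodp P W)^i 0; first by rewrite addr0.
have /minn : A (size (rmodp P W)).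
  exists (rmodp P W); split=> //.
  have := Sdiv P (rdivp P W) (lead_coef W ^+ rscalp P W) W SP SW.
  by rewrite rdivp_eq addrC addKr.
by rewrite leqNgt (leq_trans (ltn_rmodpN0 P W00)).
Qed.

(* If x is transcendental over the image of R, a non-root of the reduction is
   the new value; otherwise a root of the reduction of its minimal equation. *)
Lemma specializable_poly (x : K) : specializable iota ->
  specializable (horner_eval x \o map_poly iota : {rmorphism {poly R} -> K}).
Proof.
move=> Sp G /=; rewrite /horner_eval /= => G0.
have [H|H] := classic (forall P, P^i.[x] = 0 -> P^i = 0).
  have Gi0 : G^i != 0 by apply: contraNneq G0 => ->; rewrite horner0.
  have : lead_coef G^i != 0 by rewrite lead_coef_eq0.
  rewrite lead_coefE coef_map => /Sp[Om [p [phi [pOm kphi r0]]]].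
  have /closed_nonrootP[y y0] : map_poly phi G != 0.
    apply: contraNneq r0 => /polyP/(_ (size G^i).-1).
    by rewrite coef_map coef0 => ->.
  exists Om, p, (horner_eval y \o map_poly phi : {rmorphism {poly R} -> Om}).
  split=> // P /H PH; rewrite /= /horner_eval.
  by rewrite (@map_poly_ker _ phi P 0) // ?rmorph0 ?horner0.
have {H}exF : exists2 P, P^i.[x] = 0 & P^i != 0.
  have [P PH] := not_all_ex_not _ _ H.
  by have [Px /eqP P0] := imply_to_and _ _ PH; exists P.
(* [F] plays the role of a minimal polynomial of [x], with denominators cleared. *)
have [||F [Fx lF Fdiv]] := @minimal_divisor (fun P => P^i.[x] = 0) _ _ exF.
- by move=> P Q ->.
- move=> P Q c W Px Wx.
  by rewrite rmorphB rmorphM /= map_polyZ !hornerE Px Wx !mulr0 subr0.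
(* The ideal generated by [G] and [F], up to [iota]. Its minimal element [W] is a gcd; it turns out
   to be a constant [w], which yields a Bezout relation w = U G + V F. *)
pose S1 P := exists U V, P^i = (U * G + V * F)^i.
have SG : S1 G by exists 1, 0; rewrite mul0r mul1r addr0.
have SF : S1 F by exists 0, 1; rewrite mul0r mul1r add0r.
have Gi0 : G^i != 0 by apply: contraNneq G0 => ->; rewrite horner0.
have [||W [SW lW Wdiv]]   := @minimal_divisor S1 _ _ (ex_intro2 _ _ G SG Gi0).
- by move=> P Q PQ [U [V e]]; exists U, V; rewrite -PQ.
- move=> P Q c W [U [V e]] [U' [V' e']].
  exists (c *: U - Q * U'), (c *: V - Q * V').
  rewrite rmorphB rmorphM /= map_polyZ e e' -map_polyZ -rmorphM -rmorphB /=.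
  congr (map_poly _ _).
  by rewrite !mulrDl !mulrDr scalerDr !mulNr !mulrA !scalerAl opprD addrACA.
have [j [Q WG]] := Wdiv _ SG; have [j' [Q' WF]] := Wdiv _ SF.
have Fi0 : F^i != 0.
  apply: contraNneq lF => /polyP/(_ (size F).-1).
  by rewrite coef_map coef0 /= -lead_coefE => ->.
have Wx : W^i.[x] != 0.
  apply: contraNneq G0 => Wx; move/(congr1 (fun P => P.[x])): WG.
  rewrite map_polyZ rmorphM rmorphXn /= !hornerE Wx mulr0 => /eqP.
  by rewrite mulf_eq0 expf_eq0 (negPf lW) andbF.
have Qx : Q'^i.[x] = 0.
  move/(congr1 (fun P => P.[x])): WF.
  rewrite map_polyZ rmorphM rmorphXn /= !hornerE Fx mulr0 => /esym/eqP.
  by rewrite mulf_eq0 (negPf Wx) orbF => /eqP.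
have [j'' [Q'' QF]] := Fdiv _ Qx.
(* Up to nonzero constants, F = Q' W, and [Q'] vanishes at [x], hence Q' = Q'' F. Cancelling [F]
   shows that Q'' W is a nonzero constant. *)
have sW : size W^i = 1%N.
  have e : (iota (lead_coef F) ^+ j'' * iota (lead_coef W) ^+ j')%:P
             = Q''^i * W^i.
    rewrite !map_polyZ !rmorphM !rmorphXn /= in WF QF.
    apply: (mulIf Fi0); rewrite [RHS]mulrAC -QF -scalerAl -WF.
    by rewrite scalerA mul_polyC.
  have /eqP : size (Q''^i * W^i) == 1%N.
    by rewrite -e size_polyC mulf_neq0 ?expf_neq0.
  have W0 : W^i != 0 by apply: contraNneq Wx => ->; rewrite horner0.
  have Q0 : Q''^i != 0.
    by apply: contraTneq isT => Q0; move/eqP: e; rewrite Q0 mul0r polyC_eq0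
       mulf_eq0 !expf_eq0 (negPf lF) (negPf lW) !andbF.
  rewrite size_mul //; move: W0 Q0; rewrite -!size_poly_gt0.
  by case: (size W^i) => [|[|m]] //; case: (size Q''^i) => // m'; rewrite !addnS.
pose w := W`_0.
have Wi : W^i = (iota w)%:P.
  by rewrite [LHS]size1_polyC ?sW // coef_map.
have w0 : iota w != 0.
  by apply: contraNneq Wx; rewrite Wi hornerC => ->.
(* If [lead_coef F] survives, [F] keeps a root [y], and polynomials vanishing at [x] vanish at [y];
   if [w] survives, the Bezout relation at [y] forces G(y) to be nonzero. *)
have [|Om [p [phi [pOm kphi]]]] := Sp (w * lead_coef F).
  by rewrite rmorphM mulf_neq0.
rewrite rmorphM mulf_eq0 negb_or => /andP[pw0 pl0].
have sF : (1 < size F)%N.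
  rewrite ltnNge; apply/negP => /size1_polyC Fc.
  by move: Fx lF; rewrite Fc map_polyC hornerC lead_coefC => ->; rewrite eqxx.
have /closed_rootP[y /rootP Fy] : size (map_poly phi F) != 1%N.
  by rewrite size_map_poly_id0 ?pl0 // gtn_eqF.
exists Om, p, (horner_eval y \o map_poly phi : {rmorphism {poly R} -> Om}).
split=> //= [P|]; rewrite /horner_eval.
  move=> /Fdiv[i [Q1 /(map_poly_ker kphi)/(congr1 (fun P => P.[y]))]].
  rewrite map_polyZ rmorphM rmorphXn /= !hornerE Fy mulr0 => /eqP.
  by rewrite mulf_eq0 expf_eq0 (negPf pl0) andbF => /eqP.
case: SW => U [V]; rewrite Wi -map_polyC.
move=> /(map_poly_ker kphi)/(congr1 (fun P => P.[y])).
rewrite map_polyC rmorphD !rmorphM /= !hornerE Fy mulr0 addr0 => e.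
by apply: contraNneq pw0 => G0'; rewrite e G0' mulr0.
Qed.

End PolynomialExtension.

(** The elements are adjoined one at a time, so [R] is an iterated polynomial ring over the
    integers. *)
Lemma specializable_span (K : fieldType) (l : seq K) : [pchar K] =i pred0 ->
  exists (R : comNzRingType) (iota : {rmorphism R -> K}),
    specializable iota /\ forall x, x \in l -> exists r, iota r = x.
Proof.
move=> K0; elim: l => [|x l [R [iota [Sp onto]]]].
  by exists int, intr; split=> //; exact: specializable_int.
exists {poly R}, (horner_eval x \o map_poly iota : {rmorphism {poly R} -> K}).
split; first exact: specializable_poly.
move=> y; rewrite inE => /predU1P[->|/onto[r <-]].
  by exists 'X; rewrite /= /horner_eval map_polyX hornerX.
by exists r%:P; rewrite /= /horner_eval map_polyC hornerC.
Qed.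

(** * Multiplicity at a point *)

Lemma mnm_le_mdeg n (mu : 'X_{1..n}) i : (mu i <= mdeg mu)%N.
Proof. by rewrite mdegE (bigD1 i) //= leq_addr. Qed.

Section Multiplicity.
Variables (R : comNzRingType) (n : nat).
Implicit Types (a : 'I_n -> R) (f g : {mpoly R[n]}) (mu nu : 'X_{1..n}).

Definition translate a f : {mpoly R[n]} :=
  f \mPo [tuple 'X_i + (a i)%:MP | i < n].

HB.instance Definition _ a := GRing.LRMorphism.copy (translate a)
  (comp_mpoly [tuple 'X_i + (a i)%:MP | i < n]).

Definition order_ge (m : nat) f : Prop :=
  forall mu, (mdeg mu < m)%N -> f@_mu = 0.

Lemma order_ge_leq m m' f : (m <= m')%N -> order_ge m' f -> order_ge m f.
Proof. by move=> le_mm' H mu lt_mu; apply/H/(leq_trans lt_mu). Qed.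

Lemma order_ge_sum m (I : eqType) (r : seq I) (F : I -> {mpoly R[n]}) :
  (forall i, i \in r -> order_ge m (F i)) -> order_ge m (\sum_(i <- r) F i).
Proof.
move=> H mu lt_mu; rewrite raddf_sum /= big_seq big1 // => i ir; exact: H.
Qed.

Lemma order_geM m m' f g :
  order_ge m f -> order_ge m' g -> order_ge (m + m') (f * g).
Proof.
move=> Hf Hg mu lt_mu; rewrite mcoeffM big1 // => -[k1 k2] /= /eqP.
move: (bmnm k1) (bmnm k2) => {}k1 {}k2 mu_eq.
have [lt_m|ge_m] := ltnP (mdeg k1) m; first by rewrite Hf ?mul0r.
by rewrite [g@__]Hg ?mulr0 //; move: lt_mu; rewrite mu_eq mdegD; lia.
Qed.

Lemma order_geX m f r : order_ge m f -> order_ge (r * m) (f ^+ r).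
Proof.
move=> Hf; elim: r => [|r IH]; first by move=> mu.
by rewrite exprS mulSn; apply: order_geM.
Qed.

Lemma order_ge_prod (m : nat) (t : m.-tuple {mpoly R[n]}) :
  (forall g, g \in tval t -> order_ge 1 g) -> order_ge m (\prod_(g <- t) g).
Proof.
case: t => l /= /eqP <-; elim: l => [|g l IH] H; first by move=> mu.
rewrite big_cons /= -add1n; apply: order_geM; first by apply: H; rewrite mem_head.
by apply: IH => h hl; apply: H; rewrite inE hl orbT.
Qed.

(** Multiplicity is read on the affine cone, at the representative vector [a], from Taylor
    coefficients; this is meaningful in every characteristic. *)
Definition mult_ge (m : nat) a f : Prop := order_ge m (translate a f).

Lemma mult_ge_mull m a f g : mult_ge m a f -> mult_ge m a (g * f).
Proof.
rewrite /mult_ge rmorphM => H.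
by rewrite -[m]add0n; apply: order_geM.
Qed.

(** The value at [a] of the Hasse derivative of order [mu] of the monomial ['X_[nu]]. Where the
    subtraction truncates, the binomial coefficient is 0. *)
Definition hasse_coef a nu mu : R :=
  \prod_(i < n) (a i ^+ (nu i - mu i) *+ 'C(nu i, mu i)).

Lemma mcoeff_translateX a nu mu :
  (translate a 'X_[nu])@_mu = hasse_coef a nu mu.
Proof.
rewrite /translate comp_mpolyX.
(* A common bound on all exponents: every factor becomes a sum over the same ['I_K.+1], as
   distributing the product over the sums requires. *)
pose K := (mdeg nu + mdeg mu)%N.
have le_K i : (nu i <= K)%N /\ (mu i <= K)%N.
  by have := mnm_le_mdeg nu i; have := mnm_le_mdeg mu i; rewrite /K; lia.
pose c i j := a i ^+ (nu i - j) *+ 'C(nu i, j).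
have -> : \prod_(i < n) tnth [tuple 'X_i + (a i)%:MP | i < n] i ^+ nu i
   = \prod_(i < n) \sum_(j < K.+1) (c i j)%:MP * 'X_i ^+ j :> {mpoly R[n]}.
  apply: eq_bigr => i _; rewrite tnth_mktuple addrC exprDn.
  have [le_nu _] := le_K i.
  rewrite (big_ord_widen K.+1 (fun j => ((a i)%:MP ^+ (nu i - j) * 'X_i ^+ j)
    *+ 'C(nu i, j) : {mpoly R[n]})) //.
  rewrite big_mkcond; apply: eq_bigr => j _; rewrite /c.
  rewrite rmorphMn rmorphXn /= mulrnAl.
  by case: ifP => // /negbT; rewrite -leqNgt => lt; rewrite bin_small ?mulr0n.
rewrite bigA_distr_bigA /= raddf_sum /=.
have prodE (h : {ffun 'I_n -> 'I_K.+1}) :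
   (\prod_i ((c i (h i))%:MP * 'X_i ^+ h i) : {mpoly R[n]})@_mu
   = (\prod_i c i (h i)) * ([multinom (h i : nat) | i < n] == mu)%:R.
  rewrite big_split /= -rmorph_prod /= mcoeffCM; congr (_ * _).
  rewrite -(mcoeffX _ [multinom (h i : nat) | i < n]) mpolyXE_id.
  by congr mcoeff; apply: eq_bigr => i _; rewrite mnmE.
rewrite (bigD1 [ffun i => inord (mu i)]) //= prodE [X in _ + X]big1 ?addr0.
  have -> : [multinom ([ffun i => inord (mu i)] i : 'I_K.+1) : nat | i < n] = mu.
    apply/mnmP => i; rewrite mnmE ffunE inordK // ltnS; exact: (le_K i).2.
  rewrite eqxx mulr1 /hasse_coef;apply: eq_bigr => i _; rewrite /c.
  by rewrite ffunE inordK // ltnS; exact: (le_K i).2.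
move=> h neq; rewrite prodE; case: eqP => [mu_eq|_]; last by rewrite mulr0.
case/negP: neq; apply/eqP/ffunP => i; apply/val_inj; rewrite ffunE /=.
by rewrite inordK -mu_eq mnmE //.
Qed.

(** The list [S] may exceed the support, so that later sums can run over quotient exponents or over
    all monomials of one degree. *)
Lemma mcoeff_translate a f mu (S : seq 'X_{1..n}) :
    uniq S -> {subset msupp f <= S} ->
  (translate a f)@_mu = \sum_(nu <- S) f@_nu * hasse_coef a nu mu.
Proof.
move=> uS sub; rewrite (bigID (mem (msupp f))) /= [X in _ + X]big1 ?addr0.
  rewrite -big_filter [RHS](perm_big (msupp f)) /=; last first.
    apply: uniq_perm; rewrite ?filter_uniq // => nu; rewrite mem_filter.
    by apply/andb_idr/sub.
  rewrite /translate comp_mpolyEX raddf_sum /=; apply: eq_bigr => nu _.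
  by rewrite mcoeffZ mcoeff_translateX.
by move=> nu /memN_msupp_eq0 ->; rewrite mul0r.
Qed.

Lemma mcoeff0_translate a f : (translate a f)@_0%MM = f.@[a].
Proof.
rewrite (@mcoeff_translate a f _ (msupp f)) // mevalE; apply: eq_bigr => nu _.
congr (_ * _); apply: eq_bigr => i _.
by rewrite mnm0E subn0 bin0 mulr1n.
Qed.

Lemma mult_ge1 a f : f.@[a] = 0 -> mult_ge 1 a f.
Proof.
move=> fa0 mu; rewrite ltnS leqn0 mdeg_eq0 => /eqP ->.
by rewrite mcoeff0_translate.
Qed.

End Multiplicity.

(** Elements of the point ideal vanish at [a] itself (parameter t = 1), and orders of vanishing add
    in products. *)
Lemma ideal_pow_mult_ge (k : fieldType) n (a : 'rV[k]_n) m f :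
  ideal_pow (point_ideal a) m f -> mult_ge m (a 0) f.
Proof.
case=> r [rJ ->]; rewrite /mult_ge rmorph_sum /=; apply: order_ge_sum => x xr.
rewrite rmorphM /=; rewrite -[m in order_ge m]add0n.
apply: order_geM; first by move=> mu.
rewrite rmorph_prod /= -(big_map (translate (a 0)) predT id) /=.
apply: (order_ge_prod (t := [tuple of map (translate (a 0)) x.2])) => g.
move=> /mapP[h hx ->]; apply: mult_ge1.
rewrite -[RHS](rJ x xr h hx 1); apply: meval_eq => j; by rewrite mul1r.
Qed.

(** * Frobenius descent *)

Section Frobenius.
Variables (R : comNzRingType) (q : nat).
Hypothesis qR : [pchar R].-nat q.

Let q_gt0 : (0 < q)%N. Proof. by case/andP: qR. Qed.

(** Compare coefficients in (1+X)^nu = (1+X^q)^(nu / q) (1+X)^(nu mod q): the last factor has degree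
    at most q-1, so it must contribute X^(q-1). *)
Lemma Lucas_top (nu j : nat) : 'C(nu, j * q + q.-1)%:R =
  (if (nu %% q)%N == q.-1 then 'C((nu %/ q)%N, j) else 0%N)%:R :> R.
Proof.
have coefE m i : ((1 + 'X : {poly R}) ^+ m)`_i = 'C(m, i)%:R.
  rewrite exprDn coef_sum.
  have [lt_mi|le_im] := ltnP m i.
    rewrite bin_small // big1 // => l _.
    rewrite expr1n mul1r coefMn coefXn gtn_eqF ?mul0rn //.
    by apply: leq_trans lt_mi; rewrite ltn_ord.
  rewrite (bigD1 (Ordinal (le_im : (i < m.+1)%N))) //= big1 ?addr0.
    by rewrite expr1n mul1r coefMn coefXn eqxx.
  move=> l /negPf neq; rewrite expr1n mul1r coefMn coefXn.
  by rewrite -[i == l]/(Ordinal (le_im : (i < m.+1)%N) == l) eq_sym neq mul0rn.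
have qP : [pchar {poly R}].-nat q by rewrite (eq_pnat _ (pchar_poly _)).
rewrite -coefE {1}(divn_eq nu q) exprD mulnC exprM.
rewrite exprDn_pchar // expr1n exprDn mulr_suml coef_sum.
have lt_e : (nu %% q < q)%N by rewrite ltn_mod.
have lt_q1 : (q.-1 < q)%N by rewrite prednK.
have termE (i : 'I_((nu %/ q)%N.+1)) :
   (1 ^+ ((nu %/ q)%N - i) * ('X^q) ^+ i *+ 'C((nu %/ q)%N, i)
      * (1 + 'X) ^+ (nu %% q)%N)`_(j * q + q.-1)
   = ('C((nu %/ q)%N, i) * ((i == j :> nat) && ((nu %% q)%N == q.-1)))%:R :> R.
  rewrite expr1n mul1r mulrnAl coefMn -exprM mulrC coefMXn -[LHS]mulr_natl natrM.
  case: ltnP => [lt|le].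
    have -> : (i == j :> nat) = false by apply/negbTE/eqP => e; nia.
    by [].
  rewrite coefE; congr (_ * _%:R).
  case: (eqVneq (i : nat) j) => [->|neq] /=.
    rewrite mulnC addKn.
    case: eqP => [->|neq]; first by rewrite binn.
    by rewrite bin_small //; lia.
  by rewrite bin_small //; nia.
rewrite (eq_bigr _ (fun i _ => termE i)) -natr_sum; congr _%:R.
case: ((nu %% q)%N == q.-1); last first.
  by rewrite big1 // => i _; rewrite andbF muln0.
have [lt_j|le_j] := ltnP j (nu %/ q)%N.+1.
  rewrite (bigD1 (Ordinal lt_j)) //= eqxx muln1 big1 ?addn0 // => i neq.
  by rewrite -[i == j :> nat]/(i == Ordinal lt_j) (negPf neq) muln0.
rewrite bin_small // big1 // => i _; rewrite ltn_eqF ?muln0 //.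
exact: leq_trans le_j.
Qed.

Variable n : nat.
Implicit Types (a : 'I_n -> R) (f : {mpoly R[n]}) (mu nu : 'X_{1..n}).

Definition mnm_top mu : 'X_{1..n} := [multinom (mu i * q + q.-1)%N | i < n].
Definition mnm_quo nu : 'X_{1..n} := [multinom (nu i %/ q)%N | i < n].

Lemma mnm_topK : cancel mnm_top mnm_quo.
Proof.
move=> mu; apply/mnmP => i; rewrite !mnmE divnMDl // divn_small ?addn0 //.
by rewrite prednK.
Qed.

Lemma mdeg_mnm_top mu : mdeg (mnm_top mu) = (mdeg mu * q + n * q.-1)%N.
Proof.
rewrite !mdegE (eq_bigr (fun i => (mu i * q + q.-1)%N)); last first.
  by move=> i _; rewrite mnmE.
by rewrite big_split /= -big_distrl sum_nat_const card_ord.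
Qed.

Lemma hasse_coef_top a nu mu : hasse_coef a nu (mnm_top mu) =
  if nu == mnm_top (mnm_quo nu)
  then hasse_coef (fun i => a i ^+ q) (mnm_quo nu) mu else 0.
Proof.
rewrite /hasse_coef; case: eqP => [nuE|neq].
  apply: eq_bigr => i _; move/mnmP/(_ i): nuE; rewrite !mnmE => nuE.
  rewrite -[LHS]mulr_natr Lucas_top -exprM.
  have e : (nu i %% q)%N = q.-1.
    by rewrite nuE modnMDl modn_small // prednK.
  rewrite e eqxx mulr_natr {1}nuE; congr (_ ^+ _ *+ _).
  by rewrite subnDr mulnC mulnBr ![(q * _)%N]mulnC.
have /forallPn[i ne_i] : ~~ [forall i, nu i == mnm_top (mnm_quo nu) i].
  by apply/negP => /forallP H; apply/neq/mnmP => i; apply/eqP.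
rewrite (bigD1 i) //= -mulr_natr mnmE Lucas_top.
case: eqP => [e|_]; last by rewrite mulr0 mul0r.
by move: ne_i; rewrite !mnmE -[in X in _ == X]e -divn_eq eqxx.
Qed.

(** The coordinate of [f] at the product of all x_i^(q-1) over the q-th powers. Unlike in the
    Cartier operator, no q-th root of the coefficients is taken; the points move by Frobenius
    instead. [mnm_top] does not lower degrees, so the range bounded by [msize f] suffices. *)
Definition cartier f : {mpoly R[n]} :=
  \sum_(mu : 'X_{1..n < msize f}) f@_(mnm_top mu) *: 'X_[mu].

Lemma mcoeff_cartier f mu : (cartier f)@_mu = f@_(mnm_top mu).
Proof.
have [lt|le] := ltnP (mdeg mu) (msize f).
  exact: (mcoeff_mpoly (fun mu => f@_(mnm_top mu))).
rewrite [RHS]memN_msupp_eq0; last first.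
  apply: msize_mdeg_ge; apply: leq_trans le _; rewrite mdeg_mnm_top.
  by rewrite (leq_trans _ (leq_addr _ _)) // leq_pmulr.
rewrite raddf_sum big1 //= => i _; rewrite mcoeffZ mcoeffX.
case: eqP => [e|_]; last by rewrite mulr0.
by have := bmdeg i; rewrite e ltnNge le.
Qed.

(* By Lucas' congruence, the Hasse derivatives of cartier f at the Frobenius
   image of a are among those of f at a. *)
Lemma mult_ge_cartier m a f : mult_ge (q * (m + n)) a f ->
  mult_ge m (fun i => a i ^+ q) (cartier f).
Proof.
move=> Hf mu lt_mu.
pose S := [seq mnm_quo nu | nu <- msupp f & nu == mnm_top (mnm_quo nu)].
rewrite (@mcoeff_translate _ _ _ _ _ S); first last.
- move=> nu; rewrite !mcoeff_msupp mcoeff_cartier => H; apply/mapP.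
  exists (mnm_top nu); last by rewrite mnm_topK.
  by rewrite mem_filter mnm_topK eqxx mcoeff_msupp.
- rewrite map_inj_in_uniq ?filter_uniq ?msupp_uniq // => nu nu'.
  rewrite !mem_filter => /andP[/eqP e _] /andP[/eqP e' _] E.
  by rewrite e e' E.
(* The order of the derivative [mnm_top mu] is q |mu| + n (q-1), which is below q (m + n) as |mu| <
   m. *)
rewrite big_map big_filter big_mkcond -[RHS](Hf (mnm_top mu)); last first.
  by rewrite mdeg_mnm_top; nia.
rewrite (@mcoeff_translate _ _ _ _ _ (msupp f)) ?msupp_uniq //.
apply: eq_bigr => nu _; rewrite hasse_coef_top mcoeff_cartier.
by case: eqP => [<-|_]; rewrite ?mulr0.
Qed.

(** A monomial factor raises each exponent of the leading monomial to the next value congruent to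
    q-1 mod q, so [cartier] does not vanish. The quotient exponents are those of the original
    leading monomial, hence q d' <= d. *)
Lemma frobenius_descent d m f (P : ('I_n -> R) -> Prop) :
    f != 0 -> f \is d.-homog -> (forall a, P a -> mult_ge (q * (m + n)) a f) ->
  exists d' g, [/\ g != 0, g \is d'.-homog, (q * d' <= d)%N &
    forall a, P a -> mult_ge m (fun i => a i ^+ q) g].
Proof.
move=> f0 hf Hf; pose nu := mlead f.
have nuS : nu \in msupp f by apply: mlead_supp.
pose e := [multinom (q.-1 - nu i %% q)%N | i < n].
pose h := 'X_[e] * f.
have topE : mnm_top (mnm_quo nu) = (e + nu)%MM.
  apply/mnmP => i; rewrite mnmDE !mnmE {3}(divn_eq (nu i) q).
  by have := ltn_pmod (nu i) q_gt0; lia.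
have g_nu : (cartier h)@_(mnm_quo nu) != 0.
  by rewrite mcoeff_cartier topE /h mulrC mcoeffMX -mcoeff_msupp.
have hh : h \is (mdeg e + d).-homog.
  by apply: dhomogM => //; rewrite dhomogX.
have deg_nu : mdeg nu = d by exact: (dhomog_mf hf nuS).
exists (mdeg (mnm_quo nu)), (cartier h); split.
- by apply: contraNneq g_nu => ->; rewrite mcoeff0.
- apply/dhomogP => mu; rewrite mcoeff_msupp mcoeff_cartier -mcoeff_msupp.
  move=> /(dhomog_mf hh) /=; rewrite mdeg_mnm_top -deg_nu -mdegD -topE.
  rewrite mdeg_mnm_top => /addIn /eqP.
  by rewrite eqn_mul2r gtn_eqF // => /eqP.
- rewrite -deg_nu !mdegE big_distrr /=; apply: leq_sum => i _.
  by rewrite mnmE mulnC leq_trunc_div.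
by move=> a /Hf H; apply/mult_ge_cartier/mult_ge_mull.
Qed.

End Frobenius.

(** * Multiplicities on a grid *)

Section Grid.
Variables (K : fieldType) (n : nat).
Implicit Types (a : 'I_n -> K) (f g h : {mpoly K[n]}) (mu nu : 'X_{1..n}).

Lemma eq_lrmorphism_mpoly (F G : {lrmorphism {mpoly K[n]} -> {mpoly K[n]}}) :
  (forall i, F 'X_i = G 'X_i) -> F =1 G.
Proof.
move=> FG f; rewrite [f]mpolyE !raddf_sum /=; apply: eq_bigr => nu _.
rewrite !linearZ /=; congr (_ *: _); rewrite mpolyXE_id !rmorph_prod.
by apply: eq_bigr => i _; rewrite !rmorphXn /= FG.
Qed.

(** The number of variables is kept; that [f] does not involve x_j is expressed by
    [restrict j 0 f = f]. *)
Definition restrict (j : 'I_n) (v : K) f : {mpoly K[n]} :=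
  f \mPo [tuple if i == j then v%:MP else 'X_i | i < n].

HB.instance Definition _ j v := GRing.LRMorphism.copy (restrict j v)
  (comp_mpoly [tuple if i == j then v%:MP else 'X_i | i < n]).

Definition mnm_del (j : 'I_n) mu : 'X_{1..n} :=
  [multinom if i == j then 0%N else mu i | i < n].

Lemma restrictXU j v i : restrict j v 'X_i = if i == j then v%:MP else 'X_i.
Proof. by rewrite /restrict comp_mpolyXU -tnth_nth tnth_mktuple. Qed.

Lemma restrictC j v c : restrict j v c%:MP = c%:MP.
Proof. exact: comp_mpolyC. Qed.

Lemma translateXU a i : translate a 'X_i = 'X_i + (a i)%:MP.
Proof. by rewrite /translate comp_mpolyXU -tnth_nth tnth_mktuple. Qed.

Lemma translateC a c : translate a c%:MP = c%:MP :> {mpoly K[n]}.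
Proof. exact: comp_mpolyC. Qed.

Lemma mpolyX_del j mu : 'X_[mu] = 'X_j ^+ mu j * 'X_[mnm_del j mu] :> {mpoly K[n]}.
Proof.
rewrite mpolyXn -mpolyXD; congr mpolyX; apply/mnmP => i.
rewrite mnmDE mulmnE mnm1E mnmE eq_sym.
by case: eqP => [->|_]; rewrite ?mul1n ?addn0.
Qed.

Lemma restrictX j v mu : restrict j v 'X_[mu] = v ^+ mu j *: 'X_[mnm_del j mu].
Proof.
rewrite (mpolyX_del j) rmorphM rmorphXn /= restrictXU eqxx -mul_mpolyC rmorphXn.
congr (_ * _); rewrite mpolyXE_id rmorph_prod; apply: eq_bigr => i _.
by rewrite rmorphXn /= restrictXU mnmE; case: eqP.
Qed.

Lemma msupp_restrict j v f mu : mu \in msupp (restrict j v f) ->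
  exists nu, [/\ nu \in msupp f, mu = mnm_del j nu & v ^+ nu j != 0].
Proof.
rewrite {1}[f]mpolyE raddf_sum /= => /msupp_sum_le /flattenP[l /mapP[nu nuf ->]].
rewrite linearZ /= restrictX => /msuppZ_le H; exists nu.
have v0 : v ^+ nu j != 0.
  by apply: contraTneq H => ->; rewrite scale0r msupp0.
move: nuf; rewrite mem_filter => /andP[_ nuf].
by split=> //; move/msuppZ_le: H => /mem_msuppXP.
Qed.

Lemma mdeg_mnm_del j mu : (mdeg (mnm_del j mu) <= mdeg mu)%N.
Proof.
rewrite !mdegE; apply: leq_sum => i _; rewrite mnmE.
by case: ifP.
Qed.

Lemma msize_restrict j v f : (msize (restrict j v f) <= msize f)%N.
Proof.
rewrite [X in (X <= _)%N]msizeE big_seq; apply/bigmax_leqP_seq => mu _.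
move=> /msupp_restrict[nu [nuf -> _]].
exact: leq_ltn_trans (mdeg_mnm_del _ _) (msize_mdeg_lt nuf).
Qed.

Lemma order_ge_restrict m j f : order_ge m f -> order_ge m (restrict j 0 f).
Proof.
move=> Hf mu lt_mu; apply/eqP; rewrite mcoeff_eq0; apply/negP.
move=> /msupp_restrict[nu [nuf mu_eq]].
rewrite expr0n; case: (nu j =P 0%N) => [nuj _|]; last by rewrite eqxx.
have e : nu = mu.
  by rewrite mu_eq; apply/mnmP => i; rewrite mnmE; case: eqP => // ->.
by move: nuf; rewrite e mcoeff_msupp Hf ?eqxx.
Qed.

Definition update a j (v : K) : 'I_n -> K := fun i => if i == j then v else a i.

Lemma mult_ge_restrict m a j v f :
  mult_ge m (update a j v) f -> mult_ge m a (restrict j v f).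
Proof.
rewrite /mult_ge => /(@order_ge_restrict _ j).
suff -> : translate a (restrict j v f)
        = restrict j 0 (translate (update a j v) f) by [].
apply: (@eq_lrmorphism_mpoly (translate a \o restrict j v)
                       (restrict j 0 \o translate (update a j v))) => i /=.
rewrite restrictXU translateXU rmorphD /= restrictXU restrictC /update.
by case: eqP => _; rewrite ?translateC ?translateXU ?add0r ?mpolyC0 ?add0r.
Qed.

Lemma restrict_idem j v f : restrict j 0 (restrict j v f) = restrict j v f.
Proof.
apply: (@eq_lrmorphism_mpoly (restrict j 0 \o restrict j v) (restrict j v)) => i /=.
by rewrite restrictXU; case: eqP => [_|/eqP/negPf H]; rewrite ?restrictC // restrictXU H.
Qed.

Lemma restrict_comm i j v w f : i != j ->
  restrict i w (restrict j v f) = restrict j v (restrict i w f).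
Proof.
move=> ij; apply: (@eq_lrmorphism_mpoly (restrict i w \o restrict j v)
                                   (restrict j v \o restrict i w)) => l /=.
have [->|lj] := eqVneq l j.
  by rewrite !restrictXU eqxx eq_sym (negPf ij) restrictC restrictXU eqxx.
have [li|li] := eqVneq l i; rewrite !restrictXU (negPf lj) restrictXU.
  by rewrite li eqxx restrictC.
by rewrite (negPf li) restrictXU (negPf lj).
Qed.

Lemma restrict_dvd j v f : exists g, f - restrict j v f = ('X_j - v%:MP) * g.
Proof.
exists (\sum_(nu <- msupp f) f@_nu *: ('X_[mnm_del j nu] *
  \sum_(i < nu j) 'X_j ^+ ((nu j).-1 - i) * v%:MP ^+ i)).
rewrite [in X in X - _](mpolyE f) [in X in _ - X](mpolyE f).
rewrite [restrict j v _]raddf_sum /= -sumrB mulr_sumr; apply: eq_bigr => nu _.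
rewrite linearZ /= restrictX -scalerBr -scalerAr; congr (_ *: _).
rewrite {1}(mpolyX_del j) -mul_mpolyC rmorphXn -mulrBl subrXX /=.
by rewrite -mulrA; congr (_ * _); rewrite mulrC.
Qed.

(** If u is nonzero, the factor is invertible at the origin: the coefficients of [h] vanish
    successively by increasing degree. If u = 0, it shifts exponents and costs one order. *)
Lemma order_ge_linear m j (u : K) h : order_ge m (('X_j + u%:MP) * h) ->
  order_ge (m - (u == 0)) h.
Proof.
move=> H; have [u0|u0] := eqVneq u 0.
  move=> mu lt_mu; rewrite -(mcoeffMX h U_(j)) mulrC.
  move: (H (U_(j) + mu)%MM); rewrite u0 mpolyC0 addr0; apply.
  by rewrite mdegD mdeg1; lia.
rewrite subn0 => mu; have [d le_d] := ubnP (mdeg mu).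
elim: d mu le_d => // d IH mu le_d lt_mu.
have := H mu lt_mu; rewrite mulrDl mcoeffD mcoeffCM.
have -> : ('X_j * h)@_mu = 0.
  have [muj|muj] := eqVneq (mu j) 0%N.
    apply: memN_msupp_eq0; rewrite mulrC (perm_mem (msuppMX _ _)).
    by apply/negP => /mapP[nu _ mu_eq]; move: muj; rewrite mu_eq mnmDE mnm1E eqxx.
  have e : mu = (U_(j) + (mu - U_(j)))%MM.
    by rewrite addmC submK // lep1mP.
  rewrite e mulrC mcoeffMX; move/(congr1 (@mdeg n)): e; rewrite mdegD mdeg1 => e.
  by apply: IH; lia.
by rewrite add0r => /eqP; rewrite mulf_eq0 (negPf u0) => /eqP.
Qed.

Lemma mult_ge_linear m a j v g : mult_ge m a (('X_j - v%:MP) * g) ->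
  mult_ge (m - (a j == v)) a g.
Proof.
rewrite /mult_ge rmorphM rmorphB /= translateXU translateC.
rewrite -addrA -mpolyCB => /order_ge_linear.
by rewrite subr_eq0.
Qed.

Lemma linear_neq0 j (v : K) : 'X_j - v%:MP != 0 :> {mpoly K[n]}.
Proof.
apply/eqP => /mpolyP/(_ U_(j)%MM)/eqP.
by rewrite mcoeffB mcoeffXU mcoeffC mcoeff0 eqxx mnm1_eq0 mulr0 subr0 oner_eq0.
Qed.

Lemma msize_linear j v g :
  g != 0 -> (msize g < msize (('X_j - v%:MP) * g))%N.
Proof.
move=> g0; have := linear_neq0 j v; set l := 'X_j - _ => l0.
have sl : (1 < msize l)%N.
  rewrite -[1%N](mdeg1 j); apply: msize_mdeg_lt; rewrite mcoeff_msupp mcoeffB.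
  by rewrite mcoeffXU mcoeffC eqxx mnm1_eq0 mulr0 subr0 oner_eq0.
rewrite msizeM //; move: (msize l) (msize g) sl; lia.
Qed.

Variable t : nat.
Hypothesis t_inj : injective (fun l : 'I_t => (l : nat)%:R : K).

Definition on_grid (J : seq 'I_n) a :=
  forall i, i \in J -> exists l : 'I_t, a i = (l : nat)%:R.

(* The hyperplane x_j = c with the largest prescribed multiplicity w c divides
   f, because the restriction of f to it vanishes by induction on J. *)
Lemma grid_vanishing (J : seq 'I_n) m f : uniq J ->
    (forall i, i \notin J -> restrict i 0 f = f) -> (msize f <= t * m)%N ->
    (forall a, on_grid J a -> mult_ge m a f) -> f = 0.
Proof.
elim: J m f => [|j J IHJ] m f.
  move=> _ indep sz Hm; apply/eqP; apply: contraTT isT => f0.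
  have m0 : (0 < m)%N.
    case: m sz {Hm} => //; rewrite muln0 leqn0 msize_poly_eq0.
    by rewrite (negPf f0).
  have /mlead_supp := f0; set mu := mlead f => muf.
  have mu0 : mu = 0%MM.
    apply/mnmP => i; rewrite mnm0E; move: (muf).
    rewrite -(indep i isT) => /msupp_restrict[nu [_ -> _]].
    by rewrite mnmE eqxx.
  have tr0 : translate (fun=> 0) f = f.
    rewrite -[RHS]comp_mpoly_id /translate; congr (_ \mPo _).
    by apply: eq_from_tnth => i; rewrite !tnth_mktuple mpolyC0 addr0.
  move: muf; rewrite mcoeff_msupp mu0 -tr0 (Hm (fun=> 0)) ?eqxx //.
  by rewrite mdeg0.
move=> /= /andP[jJ uJ] indep sz Hm.
(* The multiplicity must be allowed to depend on the hyperplane x_j = c, since dividing by x_j - c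
   lowers it on that hyperplane only. *)
suff weighted (w : 'I_t -> nat) g :
    (forall i, i \notin j :: J -> restrict i 0 g = g) ->
    (msize g <= \sum_c w c)%N ->
    (forall (c : 'I_t) a, on_grid J a -> a j = (c : nat)%:R -> mult_ge (w c) a g) ->
    g = 0.
  apply: (weighted (fun=> m)) => //; first by rewrite sum_nat_const card_ord.
  move=> c a aJ aj; apply: Hm => i; rewrite inE => /predU1P[->|/aJ //].
  by exists c.
have [d] := ubnP (\sum_c w c); elim: d w g => // d IHd w g lt_d gi sg gm.
have [/eqP|] := posnP (\sum_c w c).
  by move=> s0; move: sg; rewrite (eqP s0) leqn0 msize_poly_eq0 => /eqP.
move=> s_gt0.
have /card_gt0P[c0 _] : (0 < #|'I_t|)%N.
  rewrite card_ord lt0n; apply: contraTneq s_gt0 => t0.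
  rewrite -leqNgt leqn0 sum_nat_eq0; apply/forallP => i.
  by have := ltn_ord i; rewrite {2}t0.
pose c := [arg max_(i > c0) w i].
have cmax i : (w i <= w c)%N by rewrite /c; case: arg_maxnP => // c' _; apply.
(* As [w c] is maximal, the size of [g] is at most t times [w c], which is the bound required in one
   variable less. *)
have r0 : restrict j (c : nat)%:R g = 0.
  apply: (IHJ (w c)) => // [i iJ||a aJ].
  - have [->|ij] := eqVneq i j; first exact: restrict_idem.
    by rewrite restrict_comm // gi // inE negb_or ij.
  - apply: leq_trans (msize_restrict _ _ _) (leq_trans sg _).
    have -> : (t * w c = \sum_(i < t) w c)%N by rewrite sum_nat_const card_ord.
    exact: leq_sum.
  apply: mult_ge_restrict; apply: gm; last by rewrite /update eqxx.
  move=> i iJ; rewrite /update; case: eqP => [e|_]; last exact: aJ.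
  by rewrite -e iJ in jJ.
have [g' gE] := restrict_dvd j (c : nat)%:R g.
rewrite r0 subr0 in gE.
have [g'0|g'0] := eqVneq g' 0; first by rewrite gE g'0 mulr0.
have wc_gt0 : (0 < w c)%N.
  rewrite lt0n; apply: contraTneq s_gt0 => wc0; rewrite -leqNgt leqn0.
  by rewrite sum_nat_eq0; apply/forallP => i; rewrite -leqn0 -wc0 cmax.
(* Division by x_j - c lowers both the size and the total weight by at least, respectively exactly,
   one. *)
pose w' i := (w i - (i == c))%N.
have sw : (\sum_i w i = (\sum_i w' i).+1)%N.
  rewrite (bigD1 c) //= [in RHS](bigD1 c) //= /w' eqxx.
  rewrite (eq_bigr (fun i => w i - (i == c)))%N; first by lia.
  by move=> i /negPf ->; rewrite subn0.
suff g'_eq0 : g' = 0 by rewrite gE g'_eq0 mulr0.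
apply: (IHd w'); first by rewrite -ltnS -sw.
- move=> i iJ; have ij : i != j by move: iJ; rewrite inE negb_or => /andP[].
  apply: (mulfI (linear_neq0 j (c : nat)%:R)); rewrite -gE -[RHS](gi i iJ) gE.
  by rewrite rmorphM rmorphB /= restrictXU restrictC eq_sym (negPf ij).
- by rewrite -ltnS -sw (leq_trans _ sg) // [in X in (_ < X)%N]gE msize_linear.
move=> c' a aJ aj; have := gm c' a aJ aj; rewrite {1}gE => /mult_ge_linear.
by rewrite aj /w' (inj_eq t_inj).
Qed.

End Grid.

(** Setting x_0 = 1 kills [f] by the affine case, so x_0 - 1 divides [f]. This factor is invertible
    at the origin, so the cofactor has order at least d there but degree below d. *)
Lemma grid_vanishing_homog (K : fieldType) (N t m d : nat)
    (f : {mpoly K[N.+1]}) :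
    injective (fun l : 'I_t => (l : nat)%:R : K) ->
    f \is d.-homog -> (d < t * m)%N ->
    (forall a : 'I_N.+1 -> K, a ord0 = 1 ->
       (forall i, i != ord0 -> exists l : 'I_t, a i = (l : nat)%:R) ->
       mult_ge m a f) ->
  f = 0.
Proof.
move=> t_inj hf lt_d Hm.
have sf : (msize f <= d.+1)%N.
  rewrite msizeE big_seq; apply/bigmax_leqP_seq => mu _ /(dhomog_mf hf) /= ->.
  exact: ltnSn.
pose J := rem ord0 (enum 'I_N.+1).
have memJ i : (i \in J) = (i != ord0).
  by rewrite mem_rem_uniq ?enum_uniq // !inE mem_enum andbT.
have r0 : restrict ord0 1 f = 0.
  apply: (grid_vanishing t_inj (J := J) (m := m)).
  - by rewrite rem_uniq ?enum_uniq.
  - by move=> i; rewrite memJ negbK => /eqP->; exact: restrict_idem.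
  - exact: leq_trans (msize_restrict _ _ _) (leq_trans sf lt_d).
  move=> a aJ; apply/mult_ge_restrict/Hm => [|i i0]; rewrite /update ?eqxx //.
  by rewrite (negPf i0); apply: aJ; rewrite memJ.
have [g fE] := restrict_dvd ord0 1 f; rewrite r0 subr0 in fE.
have [g0|g0] := eqVneq g 0; first by rewrite fE g0 mulr0.
have og : order_ge d g.
  have : order_ge d (('X_ord0 + (-1)%:MP) * g).
    rewrite mpolyCN -fE => mu lt_mu; apply: (dhomog_nemf_coeff hf).
    by rewrite ltn_eqF.
  by move=> /order_ge_linear; rewrite oppr_eq0 oner_eq0 subn0.
have := msize_linear ord0 1 g0; rewrite -fE => lt1.
have /msize_mdeg_lt lt2 := mlead_supp g0.
have : (mdeg (mlead g) < d)%N by move: lt1 lt2 sf; lia.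
by move=> /og /eqP; rewrite mleadc_eq0 (negPf g0).
Qed.

(** * Unisolvent point sets *)

Definition monomials (n d : nat) : seq 'X_{1..n} :=
  [seq s2m t | t : d.-tuple 'I_n <- enum (basis n d)].

Lemma mem_monomials n d mu : (mu \in monomials n d) = (mdeg mu == d).
Proof. by rewrite basis_cover. Qed.

Lemma monomials_uniq n d : uniq (monomials n d).
Proof. exact: uniq_basis. Qed.

Section Form.
Variables (R : comNzRingType) (n d : nat).

Definition form (v : 'rV[R]_(size (monomials n d))) : {mpoly R[n]} :=
  \sum_i v 0 i *: 'X_[nth 0%MM (monomials n d) i].

Lemma form_homog v : form v \is d.-homog.
Proof.
apply: rpred_sum => i _; apply: rpredZ; rewrite dhomogX /= -mem_monomials.
exact: mem_nth.
Qed.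

Lemma mcoeff_form v (i : 'I__) : (form v)@_(nth 0%MM (monomials n d) i) = v 0 i.
Proof.
rewrite raddf_sum (bigD1 i) //= mcoeffZ mcoeffX eqxx mulr1 big1 ?addr0 // => j ji.
by rewrite mcoeffZ mcoeffX nth_uniq ?monomials_uniq //
   (inj_eq val_inj) (negPf ji) mulr0.
Qed.

Lemma homog_form f : f \is d.-homog ->
  f = form (\row_i f@_(nth 0%MM (monomials n d) i)).
Proof.
move=> hf; apply/mpolyP => mu; have [/eqP mu_d|mu_d] := boolP (mdeg mu == d).
  have mu_in : mu \in monomials n d by rewrite mem_monomials mu_d.
  have lt_i : (index mu (monomials n d) < size (monomials n d))%N.
    by rewrite index_mem.
  have := mcoeff_form (\row_i f@_(nth 0%MM (monomials n d) i)) (Ordinal lt_i).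
  by rewrite mxE /= nth_index.
by rewrite !(@dhomog_nemf_coeff _ _ mdeg d) // form_homog.
Qed.

Lemma form_eq0 v : (form v == 0) = (v == 0).
Proof.
apply/eqP/eqP => [f0|->]; last by rewrite /form big1 // => i _; rewrite mxE scale0r.
by apply/rowP => i; rewrite -mcoeff_form f0 mcoeff0 mxE.
Qed.

Variables (s m : nat).
Implicit Type A : 'M[R]_(s, n).

(* The row of coefficients of a form f of degree d times this matrix lists the
   Hasse derivatives of f of order less than m at the rows of A. *)
Definition jet_mx A : 'M[R]_(size (monomials n d), #|{: 'I_s * 'X_{1..n < m}}|) :=
  \matrix_(i, j)
    let: (l, mu) := enum_val (A := {: 'I_s * 'X_{1..n < m}}) j in
    hasse_coef (A l) (nth 0%MM (monomials n d) i) mu.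

Lemma jet_mxP A v :
  v *m jet_mx A = 0 <-> forall i, mult_ge m (A i) (form v).
Proof.
have E a mu : (translate a (form v))@_mu
    = \sum_i v 0 i * hasse_coef a (nth 0%MM (monomials n d) i) mu.
  rewrite (@mcoeff_translate _ _ _ _ _ (monomials n d)) ?monomials_uniq //.
    rewrite (big_nth 0%MM) big_mkord; apply: eq_bigr => i _.
    by rewrite mcoeff_form.
  by move=> nu /(dhomog_mf (form_homog v)) /= nu_d; rewrite mem_monomials nu_d.
split=> [v0 i mu lt_mu|H].
  have /matrixP/(_ 0 (enum_rank (i, BMultinom lt_mu))) := v0.
  rewrite !mxE E => {2}<-; apply: eq_bigr => l _.
  by rewrite mxE enum_rankK.
apply/rowP => j; rewrite !mxE; case jE: (enum_val j) => [i mu].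
rewrite -[RHS](H i mu (bmdeg mu)) E.
by apply: eq_bigr => l _; rewrite mxE jE.
Qed.

(** A right inverse, rather than injectivity, is an equational certificate: it makes sense over any
    commutative ring and is carried along by ring morphisms. *)
Definition unisolvent A := exists B, jet_mx A *m B = 1%:M.

Lemma unisolvent_eq0 A f : unisolvent A -> f \is d.-homog ->
  (forall i, mult_ge m (A i) f) -> f = 0.
Proof.
move=> [B AB] /homog_form fE; rewrite fE => /jet_mxP; set v := \row_i _ => v0.
by apply/eqP; rewrite form_eq0 -[v]mulmx1 -AB mulmxA v0 mul0mx.
Qed.

End Form.

Lemma map_jet_mx (R S : comNzRingType) (phi : {rmorphism R -> S}) n d s m
    (A : 'M[R]_(s, n)) :
  map_mx phi (jet_mx d m A) = jet_mx d m (map_mx phi A).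
Proof.
apply/matrixP => i j; rewrite !mxE; case: (enum_val j) => l' mu.
rewrite rmorph_prod; apply: eq_bigr => l _.
by rewrite rmorphMn rmorphXn /= mxE.
Qed.

Lemma unisolvent_map (R S : comNzRingType) (phi : {rmorphism R -> S}) n d s m
    (A : 'M[R]_(s, n)) : unisolvent d m A -> unisolvent d m (map_mx phi A).
Proof.
by move=> [B AB]; exists (map_mx phi B); rewrite -map_jet_mx -map_mxM AB map_mx1.
Qed.

(** If e <= d, multiplying by a power of x_0 would give a forbidden form of degree d. *)
Lemma unisolvent_lt (K : fieldType) N s d m (A : 'M[K]_(s, N.+1)) e f :
    unisolvent d m A -> f != 0 -> f \is e.-homog ->
    (forall i, mult_ge m (A i) f) ->
  (d < e)%N.
Proof.
move=> uA f0 hf Hf; rewrite ltnNge; apply: contraNN f0 => le_ed.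
have : 'X_ord0 ^+ (d - e) * f == 0.
  apply/eqP; apply: (unisolvent_eq0 uA).
    have hX : 'X_ord0 ^+ (d - e) \is [in K[N.+1], (d - e).-homog].
      by rewrite mpolyXn dhomogX /= mdegMn mdeg1 mul1n.
    by have := dhomogM hX hf; rewrite subnK.
  by move=> i; apply: mult_ge_mull.
by rewrite mulf_eq0 mpolyXn -msize_poly_eq0 msizeX.
Qed.

Lemma unisolvent_field (K : fieldType) n s d m (A : 'M[K]_(s, n)) :
    (forall f, f \is d.-homog -> (forall i, mult_ge m (A i) f) -> f = 0) ->
  unisolvent d m A.
Proof.
move=> H; apply/row_freeP/inj_row_free => v /jet_mxP vA; apply/eqP.
by rewrite -form_eq0; apply/eqP/H => //; exact: form_homog.
Qed.

(** * Degree bounds, in positive characteristic and then in characteristic 0 *)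

Lemma unisolvent_frobenius (K : fieldType) p n s d m (A : 'M[K]_(s, n)) r :
    p \in [pchar K] -> unisolvent d m A ->
  unisolvent d m (map_mx (fun x => x ^+ (p ^ r)) A).
Proof.
move=> pK uA; elim: r => [|r IH].
  suff -> : map_mx (fun x => x ^+ (p ^ 0)) A = A by [].
  by apply/matrixP => i j; rewrite mxE expr1.
have := unisolvent_map (pFrobenius_aut pK) IH.
suff -> : map_mx (pFrobenius_aut pK) (map_mx (fun x => x ^+ (p ^ r)) A)
        = map_mx (fun x => x ^+ (p ^ r.+1)) A by [].
by apply/matrixP => i j; rewrite !mxE pFrobenius_autE -exprM expnSr.
Qed.

Lemma unisolvent_bound_pchar (K : fieldType) p N s d m l e
    (A : 'M[K]_(s, N.+1)) f : p \in [pchar K] -> (0 < l)%N ->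
    unisolvent d m A -> f != 0 -> f \is e.-homog ->
    (forall i, mult_ge l (A i) f) ->
  (l * d.+1 <= e * (m + N.+1))%N.
Proof.
move=> pK l_gt0 uA f0 hf Hf.
have p_pr : prime p by case/andP: pK.
(* [r] is chosen so that f^r has multiplicity at least q (m + N + 1). Rounding costs at most e l,
   which is less than q, so a single q settles the integer inequality without a limit. *)
pose k := (e * l)%N; pose q := (p ^ k)%N; pose r := ((q * (m + N.+1)) %/ l).+1.
have lt_q : (e * l < q)%N by rewrite ltn_expl // prime_gt1.
have qK : [pchar K].-nat q.
  by rewrite pnatX (eq_pnat _ (pcharf_eq pK)) pnat_id.
have r_ge : (q * (m + N.+1) <= r * l)%N by rewrite ltnW // ltn_ceil.
have r_le : (r * l <= q * (m + N.+1) + l)%N.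
  by rewrite /r mulSn addnC leq_add2r leq_trunc_div.
have [|||e' [g [g0 hg le_e' Hg]]] :=
  @frobenius_descent K q qK N.+1 (e * r) m (f ^+ r) (fun a => exists i, a = A i).
- by rewrite expf_neq0.
- exact: dhomogMn.
- move=> _ [i ->]; apply: order_ge_leq r_ge _.
  by rewrite rmorphXn; exact: order_geX (Hf i).
have lt_d : (d < e')%N.
  apply: unisolvent_lt (unisolvent_frobenius k pK uA) g0 hg _ => i.
  have := Hg _ (ex_intro _ i erefl); congr mult_ge.
  by apply: functional_extensionality => j; rewrite mxE.
have q_gt0 : (0 < q)%N by apply: leq_ltn_trans lt_q.
rewrite leqNgt; apply/negP => lt_e.
have : (q * (l * d.+1) <= q * (e * (m + N.+1)) + e * l)%N.
  apply: leq_trans (_ : q * e' * l <= _)%N.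
    by rewrite [(l * _)%N]mulnC mulnA leq_mul2r leq_mul2l lt_d !orbT.
  apply: leq_trans (_ : e * r * l <= _)%N; first by rewrite leq_mul2r le_e' orbT.
  by rewrite mulnCA -mulnDr -mulnA leq_mul2l r_le orbT.
rewrite leqNgt => /negP; apply.
apply: leq_trans (_ : q * (e * (m + N.+1)).+1 <= _)%N.
  by rewrite mulnS addnC ltn_add2r.
by rewrite leq_mul2l lt_e orbT.
Qed.

Lemma lift_mx (R S : Type) (phi : R -> S) n1 n2 (A : 'M[S]_(n1, n2)) :
  (forall i j, exists r, phi r = A i j) -> exists B, map_mx phi B = A.
Proof.
move=> H; have /fin_all_exists[F FP] : forall ij, exists r, phi r = A ij.1 ij.2.
  by move=> ij; apply: H.
by exists (\matrix_(i, j) F (i, j)); apply/matrixP => i j; rewrite !mxE FP.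
Qed.

Lemma map_mx_ker (R K L : pzRingType) (f : {rmorphism R -> K})
    (g : {rmorphism R -> L}) n1 n2 (A B : 'M[R]_(n1, n2)) :
    (forall x, f x = 0 -> g x = 0) ->
  map_mx f A = map_mx f B -> map_mx g A = map_mx g B.
Proof.
move=> ker /matrixP AB; apply/matrixP => i j; have := AB i j; rewrite !mxE.
move=> /eqP; rewrite -subr_eq0 -rmorphB => /eqP /ker /eqP.
by rewrite rmorphB subr_eq0 => /eqP.
Qed.

(** The certificate [B] and the vanishing of the jets of [f] are matrix equations with finitely many
    entries, so they survive specialization; one nonzero coefficient of [f] is kept nonzero. *)
Lemma unisolvent_bound (K : fieldType) N s d m l e (A : 'M[K]_(s, N.+1)) f :
    [pchar K] =i pred0 -> (0 < l)%N ->
    unisolvent d m A -> f != 0 -> f \is e.-homog ->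
    (forall i, mult_ge l (A i) f) ->
  (l * d.+1 <= e * (m + N.+1))%N.
Proof.
move=> K0 l_gt0 [B AB] + /homog_form fE; rewrite fE form_eq0.
set v := \row_i _ => v0 /jet_mxP vA.
pose entries n1 n2 (M : 'M[K]_(n1, n2)) :=
  [seq M ij.1 ij.2 | ij <- enum {: 'I_n1 * 'I_n2}].
have entriesP n1 n2 (M : 'M[K]_(n1, n2)) i j : M i j \in entries _ _ M.
  by apply/mapP; exists (i, j); rewrite ?mem_enum.
have [R [iota [Sp onto]]] :=
  specializable_span (entries _ _ A ++ entries _ _ B ++ entries _ _ v) K0.
have [A' AE] : exists A', map_mx iota A' = A.
  by apply: lift_mx => i j; apply: onto; rewrite mem_cat entriesP.
have [B' BE] : exists B', map_mx iota B' = B.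
  by apply: lift_mx => i j; apply: onto; rewrite !mem_cat entriesP orbT.
have [v' vE] : exists v', map_mx iota v' = v.
  by apply: lift_mx => i j; apply: onto; rewrite !mem_cat entriesP !orbT.
have [j vj] : exists j, v 0 j != 0 by apply/rV0Pn.
have [|Om [p [phi [pOm ker phi0]]]] := Sp (v' 0 j).
  by move: vj; rewrite -vE mxE.
have AB' : jet_mx d m (map_mx phi A') *m map_mx phi B' = 1%:M.
  rewrite -map_jet_mx -map_mxM -(map_mx1 phi); apply: map_mx_ker ker _.
  by rewrite map_mxM map_jet_mx AE BE AB map_mx1.
have vA' : map_mx phi v' *m jet_mx e l (map_mx phi A') = 0.
  rewrite -map_jet_mx -map_mxM -(map_mx0 phi); apply: map_mx_ker ker _.
  by rewrite map_mxM map_jet_mx AE vE vA map_mx0.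
apply: (@unisolvent_bound_pchar Om p N s d m l e (map_mx phi A')
  (form (map_mx phi v'))) => //.
- by exists (map_mx phi B').
- by rewrite form_eq0; apply/rV0Pn; exists j; rewrite mxE.
- exact: form_homog.
exact/jet_mxP.
Qed.

(** * General points *)

(** Well-ordering; a known element excludes the default value 0 of [alpha]. *)
Lemma alphaP (k : fieldType) n (J : {mpoly k[n]} -> Prop) d :
  has_hom_elt J d -> has_hom_elt J (alpha J) /\ (alpha J <= d)%N.
Proof.
move=> Jd; rewrite /alpha.
case: excluded_middle_informative => [H|[]].
  case: constructive_indefinite_description => a /= [Ja amin].
  by split=> //; exact: amin.
elim/ltn_ind: d Jd => d IH Jd.
have [[d' lt_d' Jd']|H] := classic (exists2 d', (d' < d)%N & has_hom_elt J d').
  exact: IH lt_d' Jd'.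
exists d; split=> // d' Jd'; rewrite leqNgt; apply/negP => lt_d'.
by apply: H; exists d'.
Qed.

Lemma meval_homogZ (R : comNzRingType) n d (f : {mpoly R[n]}) (c : R)
    (a : 'I_n -> R) : f \is d.-homog ->
  f.@[fun j => c * a j] = c ^+ d * f.@[a].
Proof.
move=> hf; rewrite !mevalE mulr_sumr big_seq [RHS]big_seq.
apply: eq_bigr => nu /(dhomog_mf hf) /= nu_d; rewrite mulrCA; congr (_ * _).
rewrite -nu_d mdegE -prodrXr -big_split; apply: eq_bigr => i _.
by rewrite /= exprMn.
Qed.

(** Vanishing at s points imposes s linear conditions on ['C(d + N, N)] coefficients; homogeneity
    extends it to the lines through the chosen representatives. *)
Lemma points_ideal_form (k : fieldType) N s d (A : 'M[k]_(s, N.+1)) :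
  (s < 'C(d + N, N))%N -> has_hom_elt (points_ideal A) d.
Proof.
move=> lt_s; pose b := monomials N.+1 d.
have sz : size b = 'C(d + N, N).
  by rewrite size_basis -(bin_sub (leq_addl d N)) addnK.
pose E := \matrix_(i < size b, j < s) \prod_l A j l ^+ (nth 0%MM b i) l.
have /rowV0Pn[v /sub_kermxP vE v0] : kermx E != 0.
  rewrite kermx_eq0 /row_free neq_ltn (leq_ltn_trans (rank_leq_col _)) //.
  by rewrite sz.
exists (form v); split; last by rewrite form_eq0 v0; split=> //; exact: form_homog.
move=> j c; rewrite (meval_homogZ _ _ (form_homog v)).
have -> : (form v).@[row j A 0] = (v *m E) 0 j.
  rewrite mxE /form raddf_sum; apply: eq_bigr => i _ /=.
  rewrite mevalZ mevalX mxE; congr (_ * _).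
  by apply: eq_bigr => l _; rewrite mxE.
by rewrite vE mxE mulr0.
Qed.

(** The m-th power of a form through the points; it ensures that [alpha] of the symbolic power is
    attained. *)
Lemma symbolic_power_form (k : fieldType) N s d (A : 'M[k]_(s, N.+1)) m :
  has_hom_elt (points_ideal A) d -> has_hom_elt (symbolic_power A m) (d * m).
Proof.
case=> f [fA [f0 hf]]; exists (f ^+ m); split; last first.
  by split; [rewrite expf_neq0 | exact: dhomogMn].
move=> i; exists [:: (1, [tuple of nseq m f])]; split.
  by move=> x; rewrite inE => /eqP-> g /nseqP[-> _]; exact: fA.
by rewrite big_seq1 mul1r /= big_nseq -Monoid.iteropE.
Qed.

Section GeneralPoints.
Variables (k : fieldType) (s n : nat).

Definition generic_mx : 'M[{mpoly k[s * n]}]_(s, n) :=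
  \matrix_(i, j) 'X_(mxvec_index i j).

Lemma generic_mx_eval (A : 'M[k]_(s, n)) :
  map_mx (meval (fun i => mxvec A 0 i)) generic_mx = A.
Proof. by apply/matrixP => i j; rewrite !mxE mevalXU mxvecE. Qed.

(** Principal open sets form a basis of the Zariski topology, and finite intersections of them are
    given by products. *)
Definition holds_near (A0 : 'M[k]_(s, n)) (P : 'M[k]_(s, n) -> Prop) :=
  exists g : {mpoly k[s * n]}, g.@[fun i => mxvec A0 0 i] != 0 /\
    forall A, g.@[fun i => mxvec A 0 i] != 0 -> P A.

Lemma holds_near_and A0 P Q :
  holds_near A0 P -> holds_near A0 Q -> holds_near A0 (fun A => P A /\ Q A).
Proof.
move=> [g [g0 gP]] [h [h0 hQ]]; exists (g * h); rewrite mevalM mulf_neq0 //.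
split=> // A; rewrite mevalM mulf_eq0 negb_or => /andP[gA hA].
by split; [exact: gP | exact: hQ].
Qed.

Lemma holds_near_forall A0 (I : finType) (P : I -> 'M[k]_(s, n) -> Prop) :
  (forall i, holds_near A0 (P i)) -> holds_near A0 (fun A => forall i, P i A).
Proof.
move=> /fin_all_exists[g gP]; exists (\prod_i g i); split.
  by rewrite rmorph_prod; apply/prodf_neq0 => i _; exact: (gP i).1.
move=> A; rewrite rmorph_prod => /prodf_neq0 H i; apply: (gP i).2.
exact: H.
Qed.

(** With the inverse [B] at [A0] frozen, the determinant of [jet_mx d m A *m B] is polynomial in [A]
    and equals 1 at [A0]; where it is nonzero, [B] can be corrected to a right inverse. *)
Lemma holds_near_unisolvent d m A0 :
  unisolvent d m A0 -> holds_near A0 (unisolvent d m).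
Proof.
move=> [B AB]; pose Bp := map_mx (mpolyC (s * n) (R := k)) B.
have detE A : (\det (jet_mx d m generic_mx *m Bp)).@[fun i => mxvec A 0 i]
    = \det (jet_mx d m A *m B).
  rewrite -det_map_mx map_mxM map_jet_mx generic_mx_eval; congr (\det (_ *m _)).
  by apply/matrixP => i j; rewrite /Bp !mxE /= mevalC.
exists (\det (jet_mx d m generic_mx *m Bp)); split=> [|A].
  by rewrite detE AB det1 oner_eq0.
rewrite detE -unitfE -unitmxE => uA.
by exists (B *m invmx (jet_mx d m A *m B)); rewrite mulmxA mulmxV.
Qed.

Lemma holds_near_minor (A0 : 'M[k]_(s, n)) i j c c' :
    A0 i c * A0 j c' - A0 i c' * A0 j c != 0 ->
  holds_near A0 (fun A : 'M[k]_(s, n) => A i c * A j c' - A i c' * A j c != 0).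
Proof.
move=> A00; exists (generic_mx i c * generic_mx j c'
                    - generic_mx i c' * generic_mx j c).
have E (A : 'M[k]_(s, n)) : (generic_mx i c * generic_mx j c'
    - generic_mx i c' * generic_mx j c).@[fun l => mxvec A 0 l]
    = A i c * A j c' - A i c' * A j c.
  by rewrite mevalB !mevalM !mxE !mevalXU !mxvecE.
by split=> [|A]; rewrite E.
Qed.

End GeneralPoints.

Lemma general_points_near (k : fieldType) s N (P : 'M[k]_(s, N.+1) -> Prop) A0 :
  holds_near A0 (fun A => distinct_proj_points A /\ P A) -> general_points P.
Proof.
move=> [g [g0 gP]]; exists (fun v => g.@[v] != 0); split; last first.
  by split; [exists (fun i => mxvec A0 0 i) | exact: gP].
by exists (eq g) => v; split=> [gv|[h [<-]]] //; exists g.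
Qed.

(** A nonzero minor also shows that its rows are nonzero; [1 < s] supplies a second row. *)
Lemma distinct_proj_points_minors (k : fieldType) s n (A : 'M[k]_(s, n)) :
    (1 < s)%N ->
    (forall i j, i != j -> exists c c', A i c * A j c' - A i c' * A j c != 0) ->
  distinct_proj_points A.
Proof.
move=> s_gt1 H; split=> [i|i j /H[c [c' ne0]] [x /rowP xE]].
  have [j ij] : exists j : 'I_s, i != j.
    have [e|ne] := eqVneq i (Ordinal (ltnW s_gt1)).
      by exists (Ordinal s_gt1); rewrite e.
    by exists (Ordinal (ltnW s_gt1)).
  have [c [c' ne0]] := H i j ij; apply: contraNneq ne0 => /rowP r0.
  have := r0 c; have := r0 c'; rewrite !mxE => -> ->.
  by rewrite !mul0r subrr.
have := xE c; have := xE c'; rewrite !mxE => e e'.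
by move: ne0; rewrite e e' mulrCA [in X in _ - X]mulrCA [A i c * _]mulrC subrr eqxx.
Qed.

(** * A configuration containing the grid, as a point of the open set *)

Section GridPoints.
Variables (k : fieldType) (N s t : nat).
Hypotheses (k0 : [pchar k] =i pred0) (N_gt0 : (0 < N)%N) (ts : (t ^ N <= s)%N).

Let natr_inj : injective (fun l : nat => l%:R : k).
Proof.
have /pcharf0P k0' := k0.
suff H i j : (i <= j)%N -> i%:R = j%:R :> k -> i = j.
  by move=> i j; case/orP: (leq_total i j) => le e; [|apply/esym]; apply: H.
move=> le /eqP; rewrite eq_sym -subr_eq0 -natrB // k0' subn_eq0 => le'.
by apply/eqP; rewrite eqn_leq le.
Qed.

(* The diagonal points only pad the grid to at least s distinct points. *)
Definition affine_points : seq {ffun 'I_N -> nat} :=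
  [seq [ffun i => h i : nat] | h : {ffun 'I_N -> 'I_t}
                             <- enum {: {ffun 'I_N -> 'I_t}}] ++
  [seq [ffun=> (t + l)%N] | l <- iota 0 s].

Lemma affine_points_uniq : uniq affine_points.
Proof.
rewrite cat_uniq; apply/and3P; split.
- rewrite map_inj_uniq ?enum_uniq // => h h' /ffunP e; apply/ffunP => i.
  by apply/val_inj; have := e i; rewrite !ffunE.
- apply/hasPn => h /mapP[l _ ->]; apply/negP => /mapP[h' _ /ffunP e].
  have := e (Ordinal N_gt0); rewrite !ffunE => e'.
  by have := ltn_ord (h' (Ordinal N_gt0)); rewrite -e' ltnNge leq_addr.
rewrite map_inj_uniq ?iota_uniq // => l l' /ffunP/(_ (Ordinal N_gt0)).
by rewrite !ffunE => /addnI.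
Qed.

Lemma size_affine_points : size affine_points = (t ^ N + s)%N.
Proof. by rewrite size_cat !size_map size_iota -enumT -cardE card_ffun !card_ord. Qed.

(** Only the first s points of the list are taken; the grid comes first and t^N <= s, so all of it
    is included. *)
Definition grid_mx : 'M[k]_(s, N.+1) := \matrix_(i, j)
  if unlift ord0 j is Some c then (nth [ffun=> 0%N] affine_points i c)%:R else 1.

Lemma grid_mx_minors i j : i != j -> exists c c',
  grid_mx i c * grid_mx j c' - grid_mx i c' * grid_mx j c != 0.
Proof.
move=> ij; have lt (l : 'I_s) : (l < size affine_points)%N.
  by rewrite size_affine_points (leq_trans (ltn_ord l)) // leq_addl.
have : nth [ffun=> 0%N] affine_points i != nth [ffun=> 0%N] affine_points j.
  by rewrite nth_uniq ?affine_points_uniq.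
move=> ne; have /forallPn[c ne_c] : ~~ [forall c,
  nth [ffun=> 0%N] affine_points i c == nth [ffun=> 0%N] affine_points j c].
  by apply: contra ne => /forallP e; apply/eqP/ffunP => c; apply/eqP.
(* Column 0 is constantly 1, so this minor is the difference of the c-th affine coordinates. *)
exists ord0, (lift ord0 c); rewrite !mxE unlift_none liftK mul1r mulr1 subr_eq0.
by rewrite (inj_eq natr_inj) eq_sym.
Qed.

Lemma grid_mx_unisolvent d m : (d < t * m)%N -> unisolvent d m grid_mx.
Proof.
move=> lt_d; apply: unisolvent_field => f hf Hf.
apply: (@grid_vanishing_homog k N t m d f) => //.
  by move=> i j /natr_inj /val_inj.
move=> a a0 aG.
have /fin_all_exists[h hP] : forall c : 'I_N, exists l : 'I_t,
    a (lift ord0 c) = (l : nat)%:R.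
  by move=> c; apply: aG; rewrite eq_sym neq_lift.
pose x : {ffun 'I_N -> nat} := [ffun i => finfun h i : nat].
have xin : x \in [seq [ffun i => h i : nat] | h : {ffun 'I_N -> 'I_t}
                                               <- enum {: {ffun 'I_N -> 'I_t}}].
  by apply/mapP; exists (finfun h); rewrite ?mem_enum.
have lt_x : (index x affine_points < s)%N.
  rewrite /affine_points index_cat xin (leq_trans _ ts) //.
  by move: xin; rewrite -index_mem size_map -cardE card_ffun !card_ord.
have := Hf (Ordinal lt_x); congr mult_ge; apply: functional_extensionality => j.
rewrite mxE; case: unliftP => [c|] -> //.
by rewrite nth_index ?mem_cat ?xin // hP !ffunE.
Qed.

End GridPoints.

(** * Final arithmetic and conclusion *)

(** With x = tN, cancelling N+1 and multiplying by N gives m x^2 <= am N (x+1). Since (x-1)(x+1) <=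
    x^2 and aI + N - 1 <= x - 1, the claim follows. *)
Lemma waldschmidt_arith (t N m aI am : nat) : (0 < t)%N -> (0 < N)%N ->
    (aI <= (t - 1) * N)%N ->
    (m * (t * (t * N * N.+1)) <= am * (t * N * N.+1 + N.+1))%N ->
  ((aI + N - 1) * m <= am * N)%N.
Proof.
move=> t_gt0 N_gt0 aI_le key.
have le1 : (aI + N - 1 <= t * N - 1)%N by move: aI_le; rewrite mulnBl; nia.
apply: leq_trans (leq_mul le1 (leqnn m)) _.
have x_gt0 : (0 < t * N)%N by rewrite muln_gt0 t_gt0.
have key' : (m * (t * (t * N)) <= am * (t * N).+1)%N.
  by rewrite -(leq_pmul2r (ltn0Sn N)) -!mulnA [(N * N.+1)%N]mulnC mulSn;
     move: key; rewrite -!mulnA mulSn; lia.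
rewrite -(leq_pmul2r (ltn0Sn (t * N))) [(am * N * _)%N]mulnAC.
apply: leq_trans (leq_mul key' (leqnn N)).
have -> : (m * (t * (t * N)) * N = m * (t * N * (t * N)))%N by lia.
rewrite mulnAC mulnC leq_mul2l; apply/orP; right.
by move: (t * N)%N x_gt0 => x; nia.
Qed.

Theorem theorem5p1 (k : fieldType) (N s : nat) :
  [pchar k] =i pred0 ->
  (2 <= N)%N ->
  (4 ^ N <= s)%N ->
  @general_points k s N (fun A : 'M[k]_(s, N.+1) =>
    forall m : nat, (0 < m)%N ->
      ((alpha (symbolic_power A m))%:R / m%:R : rat)
        >= (alpha (points_ideal A) + N - 1)%N%:R / N%:R).
Proof.
move=> k0 N_ge2 s_ge; have N_gt0 : (0 < N)%N by apply: ltnW.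
have [t [t_gt3 t_le s_lt]] := expn_floor_root N_gt0 s_ge.
have s_gt1 : (1 < s)%N.
  by rewrite (leq_trans _ s_ge) // (leq_trans _ (leq_pexp2l _ N_gt0)).
(* With this [M], M + N + 1 = (N+1)(tN+1), and [d] is the largest degree below tM. *)
pose M := (t * N * N.+1)%N; pose d := (t * M).-1.
have M_gt0 : (0 < M)%N by rewrite /M !muln_gt0 N_gt0 (ltn_trans _ t_gt3).
have dE : d.+1 = (t * M)%N by rewrite /d prednK // muln_gt0 M_gt0 (ltn_trans _ t_gt3).
apply: (@general_points_near _ _ _ _ (grid_mx k N s t)).
have near_minors : holds_near (grid_mx k N s t) (fun A : 'M[k]_(s, N.+1) => forall i j : 'I_s,
    i != j -> exists c c', A i c * A j c' - A i c' * A j c != 0).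
  apply: holds_near_forall => i; apply: holds_near_forall => j.
  have [->|ij] := eqVneq i j.
    by exists 1; rewrite meval1 oner_eq0; split.
  have [c [c' /holds_near_minor[g [g0 gP]]]] 
    := grid_mx_minors t k0 N_gt0 ij.
  by exists g; split=> // A /gP ne0 _; exists c, c'.
have near_unisolvent : holds_near (grid_mx k N s t) (unisolvent d M).
  by apply/holds_near_unisolvent/grid_mx_unisolvent; rewrite ?dE.
(* The open set is fixed before [m] appears: [M] and [d] depend only on t and N. *)
have [g [g0 gP]] := holds_near_and near_minors near_unisolvent.
exists g; split=> // A /gP[minors uA].
split; first exact: distinct_proj_points_minors.
(* Here e + N = tN, so forms of degree e have ['C(t * N, N)] coefficients, more than s. *)
move=> m m_gt0; pose e := ((t - 1) * N)%N.
have e_elt : has_hom_elt (points_ideal A) e.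
  apply: points_ideal_form; apply: leq_trans s_lt _.
  have -> : (e + N = t * N)%N by rewrite /e; nia.
  exact: expn_le_bin.
have [_ aI_le] := alphaP e_elt.
have [[f [fA [f0 hf]]] _] := alphaP (symbolic_power_form m e_elt).
have key : (m * (t * M) <= alpha (symbolic_power A m) * (M + N.+1))%N.
  rewrite -dE; apply: (@unisolvent_bound _ _ _ _ _ _ _ A f) => // i.
  have := ideal_pow_mult_ge (fA i); congr mult_ge.
  by apply: functional_extensionality => j; rewrite mxE.
rewrite ler_pdivrMr ?ltr0n // mulrAC ler_pdivlMr ?ltr0n // -!natrM ler_nat.
by apply: waldschmidt_arith aI_le key; rewrite // (ltn_trans _ t_gt3).
Qed.
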